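(* Let $(G,\mathfrak{B})$ be a Rota-Baxter Lie group, and let $G_+,G_-$, $K_+,K_-$, $\Theta: G_-/K_-\to G_+/K_+$ and $G_\Theta\subset G_+\times G_-$ be the objects associated with it as defined in the context. Then every element $g\in G$ can be uniquely expressed as $g=g_+g_-^{-1}$ with $(g_+,g_-)\in G_\Theta$.
   Context: For a group $G$, $\mathrm{Ad}_g h:=ghg^{-1}$. A Rota-Baxter Lie group is a Lie group $G$ with a smooth map $\mathfrak{B}:G\to G$ such that $\mathfrak{B}(g_1)\mathfrak{B}(g_2)=\mathfrak{B}(g_1\,\mathrm{Ad}_{\mathfrak{B}(g_1)}g_2)$ for all $g_1,g_2\in G$. Define $\mathfrak{B}_+:G\to G$ by $\mathfrak{B}_+(g)=g\,\mathfrak{B}(g)$. Put $G_+:=\mathrm{Im}\,\mathfrak{B}_+$, $G_-:=\mathrm{Im}\,\mathfrak{B}$, $K_+:=\{g\in G:\mathfrak{B}(g)=e\}$, $K_-:=\{g\in G:\mathfrak{B}_+(g)=e\}$. The sets $G_\pm$ are subgroups of $G$, and $K_+\subset G_+$, $K_-\subset G_-$ are normal subgroups. The map $\Theta:G_-/K_-\to G_+/K_+$ is defined by $\Theta(\overline{\mathfrak{B}(g)})=\overline{\mathfrak{B}_+(g)}$ for $g\in G$ (it is well defined), where the bar denotes the class in the quotient. Finally $G_\Theta:=\{(g_+,g_-)\in G_+\times G_- : \Theta(\overline{g_-})=\overline{g_+}\}$. *)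

(* Defs.v *)
From HB Require Import structures.
From mathcomp Require Import all_boot all_order all_algebra.
From mathcomp Require Import all_classical all_reals all_analysis.

Set Implicit Arguments.
Unset Strict Implicit.
Unset Printing Implicit Defensive.

Import numFieldNormedType.Exports.

Local Open Scope classical_set_scope.
Local Open Scope ring_scope.

(* C^k through iterated partial derivatives. [U] is meant to be open, so that
   the derivatives at points of [U] only depend on the values of [f] on [U]. *)
Fixpoint class_C (R : realType) (m k : nat) (U : set 'rV[R]_m)
    (f : 'rV[R]_m -> R) : Prop :=
  {in U, continuous f} /\
  match k with
  | 0 => True
  | k'.+1 => forall i : 'I_m,
      (forall x, U x -> derivable f x (delta_mx 0 i)) /\
      class_C k' U (fun x => 'D_(delta_mx 0 i) f x)
  end.

Definition smooth_on (R : realType) (m n : nat) (U : set 'rV[R]_m)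
    (f : 'rV[R]_m -> 'rV[R]_n) : Prop :=
  forall (j : 'I_n) (k : nat), class_C k U (fun x => f x 0 j).

(* [chart_to] is only meaningful on [chart_dom], and [chart_from] only on the
   image of [chart_dom]; see [is_chart]. *)
Record chart (R : realType) (n : nat) (M : Type) := Chart {
  chart_dom : set M;
  chart_to : M -> 'rV[R]_n;
  chart_from : 'rV[R]_n -> M
}.

Definition chart_img R n M (c : chart R n M) : set 'rV[R]_n :=
  chart_to c @` chart_dom c.

Definition is_chart R n (M : topologicalType) (c : chart R n M) : Prop :=
  [/\ open (chart_dom c), open (chart_img c),
      {in chart_dom c, cancel (chart_to c) (chart_from c)},
      {in chart_dom c, continuous (chart_to c)} &
      {in chart_img c, continuous (chart_from c)}].

(* Smoothness of [f] read in the charts [c] and [d]; the continuity of [f]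
   (required in [smooth_map]) makes the domain of this map open. *)
Definition smooth_in_charts R m n M N (c : chart R m M) (d : chart R n N)
    (f : M -> N) : Prop :=
  smooth_on (chart_to c @` (chart_dom c `&` f @^-1` chart_dom d))
            (chart_to d \o f \o chart_from c).

Definition is_smooth_atlas R n (M : topologicalType)
    (A : set (chart R n M)) : Prop :=
  [/\ forall c, A c -> is_chart c,
      forall x : M, exists2 c, A c & chart_dom c x &
      forall c d, A c -> A d -> smooth_in_charts c d id].

Definition smooth_map R m n (M N : topologicalType)
    (A : set (chart R m M)) (A' : set (chart R n N)) (f : M -> N) : Prop :=
  continuous f /\ forall c d, A c -> A' d -> smooth_in_charts c d f.

Definition prod_chart R m n M N (c : chart R m M) (d : chart R n N) :
    chart R (m + n) (M * N)%type :=
  {| chart_dom := chart_dom c `*` chart_dom d;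
     chart_to := fun p => row_mx (chart_to c p.1) (chart_to d p.2);
     chart_from := fun v => (chart_from c (lsubmx v), chart_from d (rsubmx v))
  |}.

Definition prod_atlas R m n M N (A : set (chart R m M))
    (A' : set (chart R n N)) : set (chart R (m + n) (M * N)%type) :=
  [set e | exists c d, [/\ A c, A' d & e = prod_chart c d]].

(* The atlas need not be maximal: [smooth_map] does not depend on the choice of
   an atlas among the compatible ones. *)
HB.mixin Record isLieGroup (R : realType) (n : nat) (G : Type)
    of Topological G & Group G := {
  lie_atlas : set (chart R n G);
  lie_hausdorff : hausdorff_space G;
  lie_second_countable : @second_countable G;
  lie_atlasP : is_smooth_atlas lie_atlas;
  lie_mul_smooth : smooth_map (prod_atlas lie_atlas lie_atlas) lie_atlas
                     (fun p : G * G => (p.1 * p.2)%g);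
  lie_inv_smooth : smooth_map lie_atlas lie_atlas (fun x : G => (x^-1)%g)
}.

#[short(type="lieGroupType")]
HB.structure Definition LieGroup (R : realType) (n : nat) :=
  { G of isLieGroup R n G & Topological G & Group G }.

Local Open Scope group_scope.

Definition Ad (G : groupType) (g h : G) : G := g * h * g^-1.

Definition rota_baxter_eq (G : groupType) (B : G -> G) : Prop :=
  forall g1 g2 : G, B g1 * B g2 = B (g1 * Ad (B g1) g2).

Definition rota_baxter_lie (R : realType) (n : nat) (G : lieGroupType R n)
    (B : G -> G) : Prop :=
  smooth_map (@lie_atlas R n G) (@lie_atlas R n G) B /\ rota_baxter_eq B.

Definition cosets (G : groupType) (H K : set G) : set (set G) :=
  [set C | exists2 h, H h & C = [set h * k | k in K]].

Lemma cosets_bar_subproof (G : groupType) (H K : set G) (h : H) :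
  [set val h * k | k in K] \in cosets H K.
Proof. by apply/mem_set; exists (val h) => //; apply/set_mem/valP. Qed.

Definition bar (G : groupType) (H K : set G) (h : H) : cosets H K :=
  SigSub (cosets_bar_subproof K h).

Section RotaBaxter.
Context (G : groupType) (B : G -> G).

Definition rb_plus (g : G) : G := g * B g.

Definition Gplus : set G := range rb_plus.
Definition Gminus : set G := range B.
Definition Kplus : set G := [set g | B g = 1].
Definition Kminus : set G := [set g | rb_plus g = 1].

Lemma Gplus_subproof (g : G) : rb_plus g \in Gplus.
Proof. by apply/mem_set; exists g. Qed.

Lemma Gminus_subproof (g : G) : B g \in Gminus.
Proof. by apply/mem_set; exists g. Qed.

Definition to_Gplus (g : G) : Gplus := SigSub (Gplus_subproof g).
Definition to_Gminus (g : G) : Gminus := SigSub (Gminus_subproof g).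

Lemma cosets_Gminus_rep (C : cosets Gminus Kminus) :
  exists g : G, bar Kminus (to_Gminus g) = C.
Proof.
case: C => C CP; have [_ [g _ <-] eC] := set_mem CP.
by exists g; apply: val_inj; rewrite /= eC.
Qed.

(* [Theta] is defined through a choice of a representative [B g] of the class;
   [ThetaE] shows that the choice is irrelevant. *)
Definition Theta (C : cosets Gminus Kminus) : cosets Gplus Kplus :=
  bar Kplus (to_Gplus (projT1 (cid (cosets_Gminus_rep C)))).

Definition GTheta : set (Gplus * Gminus)%type :=
  [set p | Theta (bar Kminus p.2) = bar Kplus p.1].

Hypothesis rb_eq : rota_baxter_eq B.

Lemma rb1 : B 1 = 1.
Proof.
have /(congr1 (fun x => (B 1)^-1 * x)) := rb_eq 1 1.
by rewrite /Ad mul1g mulg1 mulgV mulKg mulVg.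
Qed.

Lemma rb_plus_eq (g h : G) : rb_plus g * rb_plus h = rb_plus (g * Ad (B g) h).
Proof. by rewrite /rb_plus -rb_eq /Ad !mulgA mulgVK. Qed.

Lemma rb_inv_eq (g : G) : g * Ad (B g) (Ad (B g)^-1 g^-1) = 1.
Proof. by rewrite /Ad invgK !mulgA !mulgK mulgV. Qed.

Lemma rb_inv (g : G) : B (Ad (B g)^-1 g^-1) = (B g)^-1.
Proof. by apply: (mulgI (B g)); rewrite rb_eq rb_inv_eq rb1 mulgV. Qed.

Lemma rb_plus_inv (g : G) : rb_plus (Ad (B g)^-1 g^-1) = (rb_plus g)^-1.
Proof.
by apply: (mulgI (rb_plus g)); rewrite rb_plus_eq rb_inv_eq {1}/rb_plus rb1
  mulg1 mulgV.
Qed.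

Lemma rb_rb_plus (g : G) : B (rb_plus g) = rb_plus (B g).
Proof. by rewrite /rb_plus rb_eq /Ad mulgK. Qed.

Lemma KplusM (g h : G) : Kplus g -> Kplus h -> Kplus (g * h).
Proof.
by move=> /= Bg Bh; have := rb_eq g h; rewrite /Ad Bg Bh invg1 !mul1g mulg1.
Qed.

Lemma Kplus_rb_plus (g h : G) :
  Kminus ((B g)^-1 * B h) -> Kplus ((rb_plus g)^-1 * rb_plus h).
Proof.
by rewrite /Kminus /Kplus /mkset -rb_inv rb_eq -rb_rb_plus -rb_plus_inv
  rb_plus_eq rb_inv.
Qed.

Lemma ThetaE (g : G) :
  Theta (bar Kminus (to_Gminus g)) = bar Kplus (to_Gplus g).
Proof.
rewrite /Theta; case: cid => h /= /(congr1 val)/= eqC.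
have Km1 : Kminus 1 by rewrite /Kminus /mkset /rb_plus mul1g rb1.
have key (x y : G) : [set B x * k | k in Kminus] = [set B y * k | k in Kminus] ->
    [set rb_plus x * k | k in Kplus] `<=` [set rb_plus y * k | k in Kplus].
  move=> eqxy _ [k Kk <-]; exists ((rb_plus y)^-1 * rb_plus x * k).
    apply: KplusM => //; apply: Kplus_rb_plus.
    have [] : [set B y * k | k in Kminus] (B x).
      by rewrite -eqxy; exists 1; rewrite ?mulg1.
    by move=> k' Kk' <-; rewrite mulKg.
  by rewrite !mulgA mulgV mul1g.
by apply: val_inj => /=; apply/seteqP; split; apply: key.
Qed.

End RotaBaxter.

(* Main.v *)
Require Import Defs.
From HB Require Import structures.
From mathcomp Require Import all_boot all_order all_algebra.
From mathcomp Require Import all_classical all_reals all_analysis.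

(** Write B_+ for [rb_plus B].  Since B_+(g) = g B(g), the pair
    (B_+(g), B(g)) factorizes g, and it lies in G_Theta because Theta sends the
    class of B(g) to the class of B_+(g).

    For uniqueness, an element of G_Theta has the form (B_+(x) k, B(x)) with
    B(k) = 1, so the element it factorizes is
      g = x B(x) k B(x)^-1 = x Ad_{B(x)} k.
    The right-hand side is exactly the argument of B in the Rota-Baxter
    identity, whence B(g) = B(x) B(k) = B(x).  Thus g determines the second
    component, and with it the first.  The argument is purely algebraic: it
    holds in every group with a Rota-Baxter operator ([rota_baxter_eq]). *)

Local Open Scope group_scope.

Lemma GTheta_rb (G : groupType) (B : G -> G) (g : G) :
  rota_baxter_eq B -> GTheta (to_Gplus B g, to_Gminus B g).
Proof. by move=> rbB; rewrite /GTheta /= ThetaE. Qed.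

(** The coset equation defining G_Theta turned into an equation in G: the two
    components come from a common element x, up to a factor in K_+. *)
Lemma GTheta_split (G : groupType) (B : G -> G) (p : Gplus B * Gminus B) :
  rota_baxter_eq B -> GTheta p ->
  exists x k, [/\ B k = 1, val p.1 = rb_plus B x * k & val p.2 = B x].
Proof.
move=> rbB; case: p => p q; rewrite /GTheta /=.
have [x _ Bx] : Gminus B (val q) by apply/set_mem/valP.
have -> : q = to_Gminus B x by apply: val_inj; rewrite /= Bx.
rewrite ThetaE // => /(congr1 val) /= eqC.
have [k Bk <-] : [set rb_plus B x * k | k in Kplus B]%classic (val p).
  by rewrite eqC; exists 1; [exact: rb1 | rewrite mulg1].
by exists x, k.
Qed.

(** A factorization through G_Theta is recovered from its value by B. *)
Lemma GTheta_rb_div (G : groupType) (B : G -> G) (p : Gplus B * Gminus B) :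
  rota_baxter_eq B -> GTheta p -> B (val p.1 * (val p.2)^-1) = val p.2.
Proof.
move=> rbB /(GTheta_split _ _ _ rbB) [x [k [Bk -> ->]]].
have -> : rb_plus B x * k * (B x)^-1 = x * Ad (B x) k.
  by rewrite /rb_plus /Ad !mulgA.
by rewrite -rbB Bk mulg1.
Qed.

Theorem theorem3p5 (R : realType) (n : nat) (G : lieGroupType R n)
    (B : G -> G) (hB : rota_baxter_lie B) (g : G) :
  exists! p : (Gplus B * Gminus B)%type,
    GTheta p /\ g = (val p.1 * (val p.2)^-1)%g.
Proof.
have [_ rbB] := hB.
exists (to_Gplus B g, to_Gminus B g); split=> [|[p q] [pq_Theta g_pq]].
  by split; [exact: GTheta_rb | rewrite /= /rb_plus mulgK].
have /= Bg : B g = val q by rewrite g_pq (GTheta_rb_div _ _ _ rbB pq_Theta).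
congr pair; apply: val_inj => //=.
by rewrite /rb_plus Bg g_pq /= mulgVK.
Qed.
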